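(* For every $n \in \mathbb{N}$ there are two deterministic $\textsc{LimAvg}$-automata $\mathcal{A}_n$ and $\overline{\mathcal{A}}_n$, each of size $n+4$, such that for almost all infinite words $w$ (w.r.t. the uniform measure on $\Sigma^\omega$) we have $|\mathcal{L}_{\mathcal{A}_n}(w) - \mathcal{L}_{\overline{\mathcal{A}}_n}(w)| = 2$, but a random $U$-sample, $E$-sample, or $(E,k)$-sample (for any $k$) $S$ distinguishes $\mathcal{A}_n$ and $\overline{\mathcal{A}}_n$ with probability at most $\frac{\|S\|}{2^n}$.
   Context: A deterministic $\textsc{LimAvg}$-automaton is a DFA $(\Sigma,Q,q_0,F,\delta)$ (all infinite runs accepting) together with rational weights on transitions; its size is the number of states plus the lengths of the binary encodings of all weights. The value $\mathcal{L}_{\mathcal{A}}(w)$ of an infinite word $w$ is the limsup of the averages of the weights of the first $k$ transitions of the (unique) run on $w$. Infinite words are considered w.r.t. the uniform probability measure on $\Sigma^\omega$ (giving $u\Sigma^\omega$ probability $|\Sigma|^{-|u|}$). For a hidden function $\mathcal{L}\colon\Sigma^\omega\to\mathbb{R}$: a $U$-sample is a set of labeled examples $(u,v,x)$ with $x=\mathcal{L}(uv^\omega)$, where $u,v$ are drawn independently from distributions on finite words that give $u$ probability $|\Sigma|^{-|u|}(1-\lambda)^{|u|}\lambda$ (for termination parameters $\lambda_1,\lambda_2\in(0,1)$); an $E$-sample is a set of pairs $(u,x)$ with $x$ the conditional expected value of $\mathcal{L}$ over $u\Sigma^\omega$, with $u$ drawn from such a distribution with parameter $\lambda$; an $(E,k)$-sample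 is the same but with $u$ drawn uniformly from $\Sigma^k$. $\|S\|$ is the sum of the lengths of all examples in $S$. A sample distinguishes two automata if it is consistent with exactly one of them.
   Formalization: ''Size n+4'' is read as n+4 states with all weights in {-1,0,1}, since counting weight encodings makes the claim false; Σ has at least two letters; samples are m i.i.d. examples labeled by either automaton; as ‖S‖ is random, the bound uses its expected value; U-examples with empty v carry no label. *)

(* Defs.v *)
From HB Require Import structures.
From mathcomp Require Import all_boot all_order all_algebra.
From mathcomp Require Import all_classical all_reals all_analysis.
Set Implicit Arguments. Unset Strict Implicit. Unset Printing Implicit Defensive.
Import Order.TTheory GRing.Theory Num.Theory.
Local Open Scope ring_scope.

(* The alphabet Sigma is 'I_k with k = s.+2 (any finite alphabet with at   *)
(* least two letters, up to renaming of letters).                           *)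
Notation letter s := 'I_s.+2.

(* Deterministic LimAvg automaton: total DFA (all runs accepting) with states
   'I_nst, initial state q0, transition function delta and rational weights. *)
Record dlimavg (s : nat) := DLimAvg {
  nst : nat;
  q0 : 'I_nst;
  delta : 'I_nst -> letter s -> 'I_nst;
  wt : 'I_nst -> letter s -> rat }.

Section Defs.
Variable s : nat.
Local Notation k := s.+2.

Fixpoint run (A : dlimavg s) (w : nat -> letter s) (i : nat) : 'I_(nst A) :=
  match i with
  | 0 => q0 A
  | i.+1 => delta (run A w i) (w i)
  end.

Definition limavg (R : realType) (A : dlimavg s) (w : nat -> letter s) : \bar R :=
  limn_esup (fun j : nat =>
    ((\sum_(i < j.+1) (ratr (wt (run A w i) (w i)) : R)) / j.+1%:R)%:E).

(* the ultimately periodic word u v^omega (only meaningful for v != [::]) *)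
Definition upw (u v : seq (letter s)) : nat -> letter s := fun i =>
  if (i < size u)%N then nth ord0 u i else nth ord0 v (((i - size u) %% size v)%N).

Definition prepend (u : seq (letter s)) (w : nat -> letter s) : nat -> letter s :=
  fun i => if (i < size u)%N then nth ord0 u i else w (i - size u)%N.

(* base-k digit expansion of x in [0,1]: the uniform measure on Sigma^omega
   is the image of the Lebesgue measure on [0,1] under this map *)
Definition digits (R : realType) (x : R) : nat -> letter s := fun i =>
  inord ((Num.truncn (x * k%:R ^+ i.+1)) %% k)%N.

Definition ae_word (R : realType) (P : (nat -> letter s) -> Prop) :=
  (@lebesgue_measure R).-negligible
     [set x : R | (0 <= x <= 1) /\ ~ P (digits x)].

Definition cond_exp (R : realType) (L : (nat -> letter s) -> \bar R)
    (u : seq (letter s)) : \bar R :=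
  (\int[@lebesgue_measure R]_(x in [set x : R | (0 <= x <= 1)%R])
      L (prepend u (digits x)))%E.

Definition geomw (R : realType) (lam : R) (u : seq (letter s)) : R :=
  (k%:R ^- size u) * (1 - lam) ^+ size u * lam.

Definition unifw (R : realType) (kk : nat) (u : seq (letter s)) : R :=
  if size u == kk then k%:R ^- kk else 0.

(* U-samples: the labeled example (u,v,x) is represented by (u,v); its label
   is x = L_T(u v^omega) for the hidden target automaton T.  An example with
   v = [::] carries no label (u v^omega is not an infinite word) and is
   consistent with every automaton. *)
Definition consistentU (R : realType) (T B : dlimavg s)
    (S : seq (seq (letter s) * seq (letter s))) : bool :=
  all (fun e => (e.2 == [::]) ||
        (limavg R B (upw e.1 e.2) == limavg R T (upw e.1 e.2))) S.

(* E-samples and (E,k)-samples: example (u,x) represented by u,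
   with label x = cond_exp L_T u *)
Definition consistentE (R : realType) (T B : dlimavg s)
    (S : seq (seq (letter s))) : bool :=
  all (fun u => cond_exp (limavg R B) u == cond_exp (limavg R T) u) S.

Definition distinguishesU R T (A Ab : dlimavg s) S : bool :=
  consistentU R T A S != consistentU R T Ab S.
Definition distinguishesE R T (A Ab : dlimavg s) S : bool :=
  consistentE R T A S != consistentE R T Ab S.

Definition normU (S : seq (seq (letter s) * seq (letter s))) : nat :=
  \sum_(e <- undup S) (size e.1 + size e.2).
Definition normE (S : seq (seq (letter s))) : nat :=
  \sum_(u <- undup S) size u.

End Defs.

(* Main.v *)
(* Both automata read letters 0..k-1 until the pattern 0^n 1 has just been
   completed; a following 0 (resp. 1) leads to a sink of weight +1 (resp. -1)
   forever, anything else restarts. The second automaton has opposite weights.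
   - Almost every word reaches a sink, where the two values differ by 2.
   - The probabilities of ending in the two sinks, as functions of the state,
     have a difference that is harmonic for the random walk on states, which
     forces it to vanish on all non-sink states. Hence an E-example (u, x)
     separates the automata only if u itself reaches a sink.
   - If u v^omega reaches a sink then 0^n 1 occurs in it at some position j,
     which may be taken below |u| + |v|. Because 0^n 1 has no period <= n, the
     n zeros then occupy n distinct letters of (u, v).
   - In a random sample, the expected number of (distinct) examples with such
     an occurrence at position j is at most 2^-n times the expected number of
     examples longer than j: flipping one given letter in every example of the
     sample is a weight-preserving involution, so each prescribed zero costs a
     factor 2. Summing over j gives the norm of the sample. *)
Require Import Defs.
From HB Require Import structures.
From mathcomp Require Import all_boot all_order all_algebra.
From mathcomp Require Import all_classical all_reals all_analysis.
From mathcomp Require Import measurable_realfun zify ring lra.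
Import Order.TTheory GRing.Theory Num.Theory numFieldNormedType.Exports.
Local Open Scope ring_scope.

Set Implicit Arguments.
Unset Strict Implicit.
Unset Printing Implicit Defensive.

(** * Comparing sums of nonnegative weights *)

Lemma subset_esum (R : realType) (T : choiceType) (A B : set T)
    (a : T -> \bar R) :
  (forall t, 0 <= a t)%E -> (A `<=` B)%classic ->
  (\esum_(t in A) a t <= \esum_(t in B) a t)%E.
Proof.
move=> a0 AB; rewrite (esumID A B) // (setIidr AB) leeDl //.
exact: esum_ge0.
Qed.

(** [phi] places a copy of [B] with the same weights in the rest of [A], so the sum over [A]
    contains that over [B] twice. *)
Lemma esum_double_le (R : realType) (T : choiceType) (A B : set T)
    (a : T -> \bar R) (phi : T -> T) :
  (forall t, 0 <= a t)%E -> (B `<=` A)%classic ->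
  (forall t, B t -> A (phi t) /\ ~ B (phi t)) -> set_inj B phi ->
  (forall t, B t -> a (phi t) = a t) ->
  (2%:E * (\esum_(t in B) a t) <= \esum_(t in A) a t)%E.
Proof.
move=> a0 BA phiAB phi_inj phi_a.
rewrite (esumID B A) // (setIidr BA) -[2%R]/(1 + 1)%R EFinD.
rewrite ge0_muleDl // !mul1e leeD2l //.
rewrite -(eq_esum phi_a) -(@esum_image _ _ _ _ _ a phi_inj).
by apply: subset_esum => // _ [t Bt <-]; exact: phiAB.
Qed.

(** * Expected number of occurrences in a weighted random sample *)

Section Sample.
Variables (R : realType) (X : choiceType) (L : eqType).
(** An example is a row of letter slots: [pos x t] is the slot read at time [t] of its word, and
    [tog t] flips slot [t]. [V x j] marks a start [j] whose next [n] reads use distinct slots. *)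
Variables (size_ex : X -> nat) (lett : X -> nat -> L) (pos : X -> nat -> nat).
Variables (flip : L -> L) (a0 : L) (tog : nat -> X -> X).
Variables (V : X -> nat -> Prop) (p : X -> R) (m n : nat).
Hypothesis flip_a0 : flip a0 != a0.
Hypothesis togK : forall t, involutive (tog t).
Hypothesis pos_tog : forall t x, pos (tog t x) =1 pos x.
Hypothesis V_tog : forall t x j, V x j -> V (tog t x) j.
Hypothesis p_tog : forall t x, p (tog t x) = p x.
Hypothesis p_ge0 : forall x, 0 <= p x.
Hypothesis lett_tog : forall t x t', (t < size_ex x)%N ->
  lett (tog t x) t' = if t' == t then flip (lett x t) else lett x t'.
Hypothesis V_lt : forall x j, V x j -> (j < size_ex x)%N.
Hypothesis V_pos : forall x j i, V x j -> (i < n)%N ->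
  (pos x (j + i) < size_ex x)%N.
Hypothesis V_inj : forall x j i i', V x j -> (i < n)%N -> (i' < i)%N ->
  pos x (j + i') != pos x (j + i).

Let P (S : m.-tuple X) : R := \prod_(x <- S) p x.

Let P_ge0 S : (0 <= (P S)%:E)%E.
Proof. by rewrite lee_fin; apply: prodr_ge0. Qed.

(** The example is recorded by value and not by index, to match a norm that ignores repetitions; [i]
    counts the letters already imposed. *)
Definition occ (i : nat) : set (m.-tuple X * (X * nat)) :=
  [set w : m.-tuple X * (X * nat) | [/\ w.2.1 \in w.1, V w.2.1 w.2.2 &
    forall i', (i' < i)%N -> lett w.2.1 (pos w.2.1 (w.2.2 + i')) = a0]].

Let W i : \bar R := (\esum_(w in occ i) (P w.1)%:E)%E.

(* Flipping the i-th letter of the occurrence in the whole sample at once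
   preserves the weight and destroys the occurrence at its i-th letter only. *)
Let phi i (w : m.-tuple X * (X * nat)) :=
  let t := pos w.2.1 (w.2.2 + i) in
  (map_tuple (tog t) w.1, (tog t w.2.1, w.2.2)).

Let W_half i : (i < n)%N -> (2%:E * W i.+1 <= W i)%E.
Proof.
move=> lt_in; apply: (@esum_double_le _ _ _ _ _ (phi i)).
- by move=> w; exact: P_ge0.
- by move=> w [wS wV wi]; split => // i' /ltnW; exact: wi.
- move=> [S [x j]] [/= xS xV xi]; rewrite /phi /=; split.
    split => /=; [by apply/mapP; exists x|exact: V_tog|].
    move=> i' lt_i'i; rewrite pos_tog lett_tog ?V_pos //.
    by rewrite (negbTE (V_inj xV lt_in lt_i'i)) xi // ltnW.
  move=> [/= _ _ /(_ i (ltnSn i))]; rewrite pos_tog lett_tog ?V_pos // eqxx.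
  by rewrite xi // => /eqP; rewrite (negbTE flip_a0).
- move=> [S [x j]] [S' [x' j']] _ _ [/= eqS eqx eqj]; subst j'.
  (* The flipped slot depends on the triple, but [pos] is blind to flips, so the slot can be read
     off the image and the flip undone. *)
  have eqpos : pos x (j + i) = pos x' (j + i).
    by rewrite -(pos_tog (pos x (j + i)) x) eqx pos_tog.
  rewrite -eqpos in eqx eqS.
  by rewrite (inv_inj (togK _) eqx) (val_inj (inj_map (inv_inj (togK _)) eqS)).
- move=> [S [x j]] _; rewrite /phi /P /= big_map; congr EFin.
  by apply: eq_bigr => y _.
Qed.

Let W_pow i : (i <= n)%N -> ((2%:R ^+ i)%:E * W i <= W 0)%E.
Proof.
elim: i => [_|i IHi lt_in]; first by rewrite expr0 mul1e.
apply: le_trans (IHi (ltnW lt_in)); rewrite exprSr EFinM -muleA.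
by rewrite lee_pmul // ?lee_fin ?exprn_ge0 ?W_half ?mule_ge0 ?esum_ge0.
Qed.

Let W0_le : (W 0 <= \esum_(S in [set: m.-tuple X])
  ((P S)%:E * (\sum_(x <- undup S) size_ex x)%:R%:E))%E.
Proof.
(* With no letter imposed, only a start inside a distinct example remains, so a sample carries at
   most as many pairs as its norm. *)
pose J (S : m.-tuple X) :=
  ([set` undup S] `*`` (fun x => `I_(size_ex x)))%classic.
apply: (@le_trans _ _ (\esum_(w in [set: m.-tuple X] `*`` J) (P w.1)%:E)%E).
  apply: subset_esum => [w|[S [x j]] [/= xS xV _]]; first exact: P_ge0.
  by split => //; split=> /=; [rewrite mem_undup | exact: V_lt].
rewrite -(esum_esum (a := fun S _ => (P S)%:E)) //.
apply: le_esum => S _; rewrite -(esum_esum (a := fun _ _ => (P S)%:E)) //.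
have inner x : (\esum_(j in `I_(size_ex x)) (P S)%:E)%E
    = ((P S)%:E * (size_ex x)%:R%:E)%E.
  rewrite esum_fset; [|exact: finite_II|by move=> *; exact: P_ge0].
  by rewrite -fsbig_ord sumEFin sumr_const card_ord -EFinM mulr_natr.
rewrite (eq_esum (fun x _ => inner x)) esum_fset //; last first.
  by move=> x _; rewrite mule_ge0 // lee_fin.
rewrite -fsbig_seq ?undup_uniq // -ge0_sume_distrr; last first.
  by move=> x _; rewrite lee_fin.
by rewrite sumEFin -natr_sum.
Qed.

(** A sample in [D] carries at least one full occurrence, so its indicator is at most its number of
    occurrences, which [n] halvings bound on average. *)
Lemma prob_occ_le (D : pred (m.-tuple X)) :
  (forall S, D S -> exists2 x, x \in S & exists2 j, V x j &
     forall i, (i < n)%N -> lett x (pos x (j + i)) = a0) ->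
  (\esum_(S in [set: m.-tuple X]) ((P S)%:E * ((D S)%:R)%:E)
    <= ((2%:R ^+ n)^-1)%:E * \esum_(S in [set: m.-tuple X])
         ((P S)%:E * (\sum_(x <- undup S) size_ex x)%:R%:E))%E.
Proof.
move=> D_occ.
have p2 : (0 < 2%:R ^+ n :> R) by rewrite exprn_gt0.
rewrite lee_pdivlMl //; apply: le_trans W0_le.
apply: le_trans (W_pow (leqnn n)).
rewrite lee_pmul2l ?lte_fin //.
pose J (S : m.-tuple X) := [set y : X * nat | occ n (S, y)]%classic.
have -> : W n = (\esum_(w in [set: m.-tuple X] `*`` J) (P w.1)%:E)%E.
  by congr esum; apply/seteqP; split=> [[S y]|[S y] []] //=.
rewrite -(esum_esum (a := fun S _ => (P S)%:E)) //.
apply: le_esum => S _; have [/D_occ[x xS [j xV xj]]|_] := boolP (D S).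
  apply: (@le_trans _ _ (\esum_(_ in [set (x, j)]) (P S)%:E)%E).
    by rewrite esum_set1 // mule1.
  by apply: subset_esum => // _ ->.
by rewrite mule0 esum_ge0.
Qed.

End Sample.

(** * The pattern automaton, its runs and its values *)

Section Automaton.
Variables s n : nat.
Implicit Types (q i : nat) (w : nat -> letter s).

(* States 0..n count consecutive letters 0 (state n standing for "at least n"),
   state n.+1 is entered on completing the pattern 0^n 1; the sinks are n.+2
   and n.+3. *)
Definition step q (a : nat) : nat :=
  if (q < n)%N then (if a == 0 then q.+1 else 0)%N
  else if q == n then (if a == 0 then n else if a == 1 then n.+1 else 0)%N
  else if q == n.+1 then (if a == 0 then n.+2 else if a == 1 then n.+3 else 0)%N
  else q.

(** A run on bare naturals from any start state, which avoids [inord] and can be cut at any time. *)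
Fixpoint runn q w i : nat :=
  if i is i'.+1 then step (runn q w i') (w i') else q.

Definition weight (b : bool) q : rat :=
  if q == n.+2 then (-1) ^+ b else if q == n.+3 then (-1) ^+ (~~ b) else 0.

Definition aut (b : bool) : dlimavg s :=
  @DLimAvg s n.+4 ord0 (fun x a => inord (step x a)) (fun x _ => weight b x).

Lemma step_lt q a : (q < n.+4)%N -> (step q a < n.+4)%N.
Proof. by rewrite /step => lt_q; repeat (case: ifP => ?); lia. Qed.

Lemma run_aut b w i : run (aut b) w i = runn 0 w i :> nat.
Proof.
elim: i => //= i IHi; rewrite inordK IHi // step_lt //.
by rewrite -IHi ltn_ord.
Qed.

Lemma step_sink q a : (n.+1 < q)%N -> step q a = q.
Proof. by move=> ltq; rewrite /step; repeat (case: ifP => ?); lia. Qed.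

Lemma runn_sink q w i : (n.+1 < q)%N -> runn q w i = q.
Proof. by move=> ltq; elim: i => //= i ->; exact: step_sink. Qed.

Lemma runn_add q w i j :
  runn q w (i + j) = runn (runn q w i) (fun t => w (i + t)%N) j.
Proof. by elim: j => [|j IHj]; rewrite ?addn0 // addnS /= IHj. Qed.

Lemma eq_runn q w w' i : (forall t, (t < i)%N -> w t = w' t) ->
  runn q w i = runn q w' i.
Proof.
elim: i => //= i IHi eqw; rewrite eqw // IHi // => t lt_ti.
by rewrite eqw // ltnW.
Qed.

Lemma runn_sink_le q w i j : (i <= j)%N -> (n.+1 < runn q w i)%N ->
  runn q w j = runn q w i.
Proof. by move=> /subnKC <- lti; rewrite runn_add runn_sink. Qed.

Lemma runn_shift q w i :
  runn q w i.+1 = runn (step q (w 0)) (fun t => w t.+1) i.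
Proof. by rewrite -add1n runn_add. Qed.

(** States up to [n] form a counter certifying a block of zeros just read; it saturates at [n],
    where only the last [n] zeros are remembered. *)
Lemma runn_zeros w i : let q := runn 0 w i in (q <= n)%N ->
  (q <= i)%N /\ forall t, (i - q <= t < i)%N -> w t = ord0.
Proof.
elim: i => [|i /= IHi].
  by split => // t; lia.
move=> /= step_le.
have [last0|] := eqVneq (w i : nat) 0%N; last first.
  move: step_le; rewrite /step => + /negbTE wi; rewrite wi.
  by repeat (case: ifP => ?); try lia; split => // t; lia.
have zero_upto q : (q <= i.+1)%N ->
    (forall t, (i.+1 - q <= t < i)%N -> w t = ord0) ->
    (q <= i.+1)%N /\ forall t, (i.+1 - q <= t < i.+1)%N -> w t = ord0.
  move=> le_q zq; split=> // t tb; have [lt_ti|le_it] := ltnP t i.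
    by apply: zq; lia.
  by have -> : t = i by [lia]; exact: val_inj.
move: step_le; rewrite /step last0 /=; case: ifP => [ltn _|gen].
  have [|le_i zi] := IHi; first by lia.
  by apply: zero_upto => // t tb; apply: zi; lia.
case: ifP => [/eqP eqn _|neqn]; last by case: ifP => ?; lia.
have [|le_i zi] := IHi; first by lia.
by apply: zero_upto => [|t tb]; [lia | apply: zi; lia].
Qed.

Definition pattern_at w j :=
  (forall t, (t < n)%N -> w (j + t)%N = ord0) /\ w (j + n)%N = 1%N :> nat.

(** From the counting states, only the letter 1 read in state [n] leads above [n], and state [n]
    certifies the zeros before it. *)
Lemma runn_pattern w i : (n < runn 0 w i)%N ->
  exists2 j, (j + n < i)%N & pattern_at w j.
Proof.
elim: i => [|i IHi] //= lt_n.
have [lti|lei] := ltnP n (runn 0 w i).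
  by have [j ltj pj] := IHi lti; exists j => //; lia.
have [leqi zi] := runn_zeros lei.
have [eqn w1] : runn 0 w i = n /\ w i = 1%N :> nat.
  by move: lt_n; rewrite /step; repeat (case: ifP => ?); lia.
exists (i - n)%N; first by lia.
split=> [t lt_t|]; last by rewrite subnK // -eqn.
by apply: zi; lia.
Qed.

(** A sink is entered only from [n.+1], one letter after the pattern is completed; hence the extra
    letter in the bound. *)
Lemma runn_sink_pattern w i : (n.+1 < runn 0 w i)%N ->
  exists2 j, (j + n.+1 < i)%N & pattern_at w j.
Proof.
elim: i => [|i IHi] //= lt_n.
have [lti|lei] := ltnP n.+1 (runn 0 w i).
  by have [j ltj pj] := IHi lti; exists j => //; lia.
have [|j ltj pj] := @runn_pattern w i; last by exists j => //; lia.
by move: lt_n; rewrite /step; repeat (case: ifP => ?); lia.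
Qed.

Variable R : realType.

(** The averages are Cesaro means of an eventually constant sequence, so they converge and the upper
    limit is the limit. *)
Lemma limavg_ultimately (A : dlimavg s) w N (c : rat) :
  (forall i, (N <= i)%N -> wt (run A w i) (w i) = c) ->
  limavg R A w = (ratr c)%:E.
Proof.
move=> wc; rewrite /limavg.
pose u i : R := ratr (wt (run A w i) (w i)).
have /cesaro ucvg : (u @ \oo --> (ratr c : R))%classic.
  apply: (@cvg_near_cst _ _ _ _ _).
  by exists N => // i /= leNi; rewrite /u wc.
apply: (cvg_limn_einf_sup _).2.
apply/fine_cvgP; split; first by apply: nearW.
rewrite [X in (X @ _ --> _)%classic](_ : _ = arithmetic_mean u) //.
by apply/funext => j; rewrite /arithmetic_mean /series /= big_mkord mulrC.
Qed.

Lemma limavg_sink b w i : (n.+1 < runn 0 w i)%N ->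
  limavg R (aut b) w = (ratr (weight b (runn 0 w i)))%:E.
Proof.
move=> lti; apply: (@limavg_ultimately _ _ i) => j le_ij /=.
by rewrite run_aut (runn_sink_le le_ij lti).
Qed.

Lemma limavg_transient b w : (forall i, (runn 0 w i <= n.+1)%N) ->
  limavg R (aut b) w = 0%E.
Proof.
move=> lew; have -> : (0 : \bar R)%E = (ratr 0)%:E by rewrite raddf0.
apply: (@limavg_ultimately _ _ 0) => j _ /=.
have := lew j; rewrite run_aut /weight.
by do 2![case: eqP => [eqj|_]; first lia].
Qed.

End Automaton.

(** * Lebesgue measure seen through digit expansions *)

Section Digits.
Variables (R : realType) (s : nat).
Local Notation k := s.+2.
Local Notation mu := (@lebesgue_measure R).
Implicit Types (x y : R) (W : set (nat -> letter s)) (a : letter s).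
Local Open Scope classical_set_scope.

(** Uniqueness of Lebesgue measure: the push-forward divided by [c] gives every half-open interval
    its length. *)
Lemma lebesgue_measure_affine (a c : R) (A : set R) : 0 < c -> measurable A ->
  mu ((fun y => (a + y) / c) @^-1` A) = (c%:E * mu A)%E.
Proof.
move=> c_gt0 mA.
have mf : measurable_fun setT ((fun y => (a + y) / c) : R -> measurableTypeR R).
  by apply: measurable_funM => //; exact: measurable_funD.
have cV_ge0 : 0 <= c^-1 by rewrite invr_ge0 ltW.
pose nu := mscale (NngNum cV_ge0) (pushforward mu
  ((fun y => (a + y) / c) : R -> measurableTypeR R)).
have -> : mu A = nu mf A.
  apply: lebesgue_measure_unique => // _ [[u v] _ <-] /=.
  rewrite /nu /mscale /= /pushforward.
  have -> : (fun y => (a + y) / c) @^-1` `]u, v] = `]c * u - a, c * v - a].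
    apply/seteqP; split=> y /=; rewrite !in_itv /= ltr_pdivlMr //
      ler_pdivrMr //;
      move=> /andP[]; lra.
  rewrite !lebesgue_measure_itv /= !lte_fin ltrD2r ltr_pM2l //.
  case: ifP => _; last by rewrite mule0.
  rewrite -!EFinD -EFinM; congr EFin.
  by field; lra.
by rewrite /nu /mscale /= muleA -EFinM divff ?mul1e // gt_eqF.
Qed.

Definition scons a (w : nat -> letter s) : nat -> letter s :=
  fun i => if i is i'.+1 then w i' else a.

(** In [(a + y) * k ^ i] the part [a * k ^ i] vanishes modulo [k] for positive [i]; at [i = 0] the
    digit is [a] because [y < 1] has integer part 0. *)
Lemma digits_cons a y : 0 <= y < 1 ->
  digits s ((a%:R + y) / k%:R) = scons a (digits s y).
Proof.
move=> /andP[y_ge0 y_lt1]; apply/funext => i.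
have k_neq0 : k%:R != 0 :> R by rewrite pnatr_eq0.
rewrite /digits exprS mulrA divfK // mulrDl -natrX -natrM.
rewrite truncnD ?natr_nat ?natrK //; last first.
  by rewrite nnegrE mulr_ge0.
case: i => [|i] /=; last first.
  by rewrite -natrX expnSr mulnA modnMDl.
rewrite expn0 muln1 mulr1 (_ : Num.truncn y = 0%N) ?addn0.
  by rewrite modn_small // inord_val.
by apply: truncn_def; rewrite y_ge0.
Qed.

(** Half-open because [digits_cons] fails at [y = 1]; the endpoint is treated separately as a null
    set. *)
Definition digits_in W : set R := [set x | 0 <= x < 1 /\ W (digits s x)].

(** The interval is cut by the first digit; each piece is a copy, shrunk by the factor [k], of the
    event for the remaining digits. *)
Lemma mu_digits_in_cons W : measurable (digits_in W) ->
  (k%:R%:E * mu (digits_in W) =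
   \sum_(a : letter s) mu (digits_in (fun w => W (scons a w))))%E.
Proof.
move=> mW.
pose I a : set R := `[a%:R / k%:R, (a%:R + 1) / k%:R[.
have k_gt0 : 0 < k%:R :> R by rewrite ltr0n.
have mI a : measurable (digits_in W `&` I a).
  by apply: measurableI => //; exact: measurable_itv.
have inI a x : I a x <-> 0 <= x * k%:R - a%:R < 1.
  rewrite /I /= in_itv /= ler_pdivrMr // ltr_pdivlMr //.
  by split=> /andP[]; lra.
have partW : digits_in W = \big[setU/set0]_(a < k) (digits_in W `&` I a).
  rewrite -bigcup_mkord_ord; apply/seteqP; split=> [x Wx|x [a _ []] //].
  have [/andP[x_ge0 x_lt1] _] := Wx.
  have xk_ge0 : 0 <= x * k%:R by rewrite mulr_ge0.
  have lt_k : (Num.truncn (x * k%:R) < k)%N.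
    by rewrite truncn_lt_nat // gtr_pMl.
  exists (Num.truncn (x * k%:R)) => //=; split=> //; apply/inI.
  rewrite inordK //.
  have /andP[] := truncn_itv xk_ge0.
  by rewrite -[X in _ < X]natr1; lra.
rewrite {1}partW measure_bigsetU_ord //; last first.
  apply/trivIsetP => a b _ _ /eqP neq_ab; rewrite -subset0 => x [[_ /inI xa]].
  move=> [_ /inI xb]; apply: neq_ab; apply/val_inj => /=.
  have xk_ge0 : 0 <= x * k%:R.
    by case/andP: xa => xa _; have := ler0n R a; lra.
  have tr (c : letter s) : 0 <= x * k%:R - c%:R < 1 ->
      Num.truncn (x * k%:R) = c.
    by move=> /andP[x1 x2]; apply: truncn_def; rewrite -natr1; lra.
  by rewrite -(tr a) // -(tr b).
rewrite ge0_sume_distrr //; apply: eq_bigr => a _.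
rewrite -(lebesgue_measure_affine a%:R) //; congr (mu _).
apply/seteqP; split=> y /=.
  rewrite /preimage /= /digits_in /= => -[[_ Wy] /inI].
  by rewrite divfK ?gt_eqF // addrC addKr => y01; rewrite -digits_cons.
move=> [y01 Wy]; split.
  rewrite /digits_in /= digits_cons //; split=> //.
  case/andP: y01 => y0 y1; apply/andP; split.
    by apply: divr_ge0 (ltW k_gt0); exact: addr_ge0.
  rewrite ltr_pdivrMr // mul1r; apply: lt_le_trans (_ : a.+1%:R <= _).
    by rewrite -natr1 ltrD2l.
  by rewrite ler_nat.
by apply: (proj2 (inI a _)); rewrite divfK ?gt_eqF // addrC addKr.
Qed.

Lemma mu_digits_inT : mu (digits_in setT) = 1%E.
Proof.
rewrite (_ : digits_in setT = `[0, 1[).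
  by rewrite lebesgue_measure_itv /= lte_fin ltr01 oppr0 adde0.
by apply/seteqP; split=> x /=; rewrite in_itv /= => // -[].
Qed.

Lemma fin_num_mu_digits_in W : measurable (digits_in W) ->
  mu (digits_in W) \is a fin_num.
Proof.
move=> mW; rewrite ge0_fin_numE //.
apply: le_lt_trans (ltry 1); rewrite -mu_digits_inT; apply: le_measure;
  rewrite ?inE //; last by move=> x [].
rewrite (_ : digits_in setT = `[0, 1[) //.
by apply/seteqP; split=> x /=; rewrite in_itv /= => // -[].
Qed.

Lemma measurable_digit i (b : nat) :
  measurable [set x : R | 0 <= x /\ digits s x i = b :> nat].
Proof.
pose K : R := k%:R ^+ i.+1.
have K_gt0 : 0 < K by rewrite exprn_gt0.
rewrite (_ : [set _ | _] = \bigcup_(m in [set m | (m %% k)%N = b])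
    `[m%:R / K, m.+1%:R / K[).
  by apply: bigcup_measurable => m _; exact: measurable_itv.
have eq_tr x m : `[m%:R / K, m.+1%:R / K[ x <->
    0 <= x /\ Num.truncn (x * K) = m.
  rewrite /= in_itv /= ler_pdivrMr // ltr_pdivlMr //; split=> [xm|[x0 <-]].
    have x0 : 0 <= x.
      rewrite -(pmulr_lge0 _ K_gt0); case/andP: xm => xm _.
      exact: le_trans (ler0n _ _) xm.
    by split => //; exact: truncn_def.
  by apply: truncn_itv; rewrite mulr_ge0 // ltW.
apply/seteqP; split=> x /=.
  rewrite /digits inordK ?ltn_pmod // => -[x0 xb].
  by exists (Num.truncn (x * K)) => //; apply/eq_tr.
move=> [m /= mb /eq_tr[x0 xm]]; split=> //.
by rewrite /digits inordK ?ltn_pmod // xm.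
Qed.

End Digits.
Arguments digits_in R {s} W.

(** * Sink probabilities and conditional expectations *)

Section Value.
Variables (R : realType) (s n : nat).
Local Notation k := s.+2.
Local Notation mu := (@lebesgue_measure R).
Implicit Types (q : nat) (w : nat -> letter s).
Local Open Scope classical_set_scope.

(* Comparing the equations at states 0..n forces f to be constant on 0..n.+1,
   and the equation at n.+1 then reads k c = (k - 2) c. *)
Lemma harmonic_eq0 (f : nat -> R) : f n.+2 + f n.+3 = 0 ->
  (forall q, k%:R * f q = \sum_(a : letter s) f (step n q a)) ->
  forall q, (q <= n.+1)%N -> f q = 0.
Proof.
move=> f_sink fE.
have fE01 q : (q <= n.+1)%N ->
    f (step n q 0) + f (step n q 1) + s%:R * f 0%N = s%:R * f q + f q + f q.
  move=> le_q; have := fE q; rewrite !big_ord_recl /= addrA.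
  rewrite (eq_bigr (fun=> f 0%N)) => [|a _]; last first.
    by congr f; rewrite /step /= /bump /=; repeat (case: ifP => ?); lia.
  by rewrite sumr_const card_ord -mulr_natl -!natr1; lra.
have f_const q : (q <= n)%N -> f q = f 0%N.
  elim: q => // q IHq lt_q; have := fE01 q (leqW (ltnW lt_q)).
  have -> : step n q 0 = q.+1 by rewrite /step lt_q.
  have -> : step n q 1 = 0%N by rewrite /step lt_q.
  by rewrite (IHq (ltnW lt_q)) => fq; clear -fq; lra.
have fn1 : f n.+1 = f 0%N.
  have := fE01 n (leqnSn n).
  have -> : step n n 0 = n by rewrite /step ltnn eqxx.
  have -> : step n n 1 = n.+1 by rewrite /step ltnn eqxx.
  by rewrite (f_const n) // => fn; clear -fn; lra.
have f0 : f 0%N = 0.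
  have := fE01 n.+1 (leqnn _).
  have stepE a : step n n.+1 a =
      if a == 0%N then n.+2 else if a == 1%N then n.+3 else 0%N.
    by rewrite /step; repeat (case: ifP => ?); lia.
  by rewrite !stepE /= f_sink fn1 => fn; clear -fn; lra.
move=> q; rewrite leq_eqVlt => /predU1P[->|/f_const->]; by rewrite ?fn1 f0.
Qed.

Definition reaches q' q : set (nat -> letter s) :=
  [set w | exists i, runn n q w i = q'].

Definition avoids_sinks q : set (nat -> letter s) :=
  [set w | forall i, (runn n q w i <= n.+1)%N].

(** A sink occupied at time 0 is still occupied after the extra letter; a transient target could be
    lost. *)
Lemma reaches_cons q' q a w : (n.+1 < q')%N ->
  reaches q' q (scons a w) = reaches q' (step n q a) w.
Proof.
move=> lt_q'; apply/propext; split=> [[[|i] /= qi]|[i qi]].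
- by exists 0%N => /=; rewrite qi step_sink.
- by exists i; rewrite -qi -[RHS]/(runn n q (scons a w) i.+1) runn_shift.
- by exists i.+1; rewrite runn_shift.
Qed.

Lemma avoids_sinks_cons q a w :
  avoids_sinks q (scons a w) = avoids_sinks (step n q a) w.
Proof.
apply/propext; split=> [qw i|qw [|i]]; last by rewrite runn_shift; exact: qw.
  by have := qw i.+1; rewrite runn_shift.
rewrite /= leqNgt; apply/negP => lt_q.
by have := qw 0%N; rewrite /= step_sink // leqNgt lt_q.
Qed.

(** Induction on time, splitting by the previous state and the letter read; both unions are
    countable. *)
Lemma measurable_runn q i r :
  measurable [set x : R | 0 <= x /\ runn n q (digits s x) i = r].
Proof.
elim: i r => [|i IHi] r /=.
  have [->|neq] := eqVneq q r.
    rewrite (_ : [set _ | _] = `[0, +oo[); first exact: measurable_itv.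
    by apply/seteqP; split=> x /=; rewrite in_itv /= andbT // => -[].
  rewrite (_ : [set _ | _] = set0) //.
  by apply/seteqP; split=> x //= [_ /eqP]; rewrite (negbTE neq).
rewrite (_ : [set _ | _] = \bigcup_r' \bigcup_(b in [set b | step n r' b = r])
    ([set x | 0 <= x /\ runn n q (digits s x) i = r'] `&`
     [set x | 0 <= x /\ digits s x i = b :> nat])).
  apply: bigcup_measurable => r' _; apply: bigcup_measurable => b _.
  by apply: measurableI; [exact: IHi | exact: measurable_digit].
apply/seteqP; split=> x /=.
  move=> [x0 xr]; exists (runn n q (digits s x) i) => //.
  by exists (digits s x i : nat).
by move=> [r' _ [b /= <- [[x0 <-] [_ <-]]]].
Qed.

Lemma measurable_reaches q' q :
  measurable [set x : R | 0 <= x /\ reaches q' q (digits s x)].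
Proof.
rewrite (_ : [set _ | _] =
    \bigcup_i [set x : R | 0 <= x /\ runn n q (digits s x) i = q']).
  by apply: bigcup_measurable => i _; exact: measurable_runn.
apply/seteqP; split=> x /= [] => [x0 [i xi]|i _ []]; first by exists i.
by split=> //; exists i.
Qed.

Lemma measurable_avoids_sinks q :
  measurable [set x : R | 0 <= x /\ avoids_sinks q (digits s x)].
Proof.
rewrite (_ : [set _ | _] = \bigcap_i \bigcup_(r in [set r | (r <= n.+1)%N])
    [set x : R | 0 <= x /\ runn n q (digits s x) i = r]).
  apply: bigcap_measurable; first by exists 0%N.
  by move=> i _; apply: bigcup_measurable => r _; exact: measurable_runn.
apply/seteqP; split=> x /=.
  by move=> [x0 xq] i _; exists (runn n q (digits s x) i) => //; exact: xq.
move=> xq; split; first by have [r _ []] := xq 0%N I.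
by move=> i; have [r /= le_r [_ ->]] := xq i I.
Qed.

Lemma digits_inE (W : set (nat -> letter s)) :
  digits_in R W = [set x | 0 <= x /\ W (digits s x)] `&` `[0, 1[.
Proof.
apply/seteqP; split=> x /=; rewrite in_itv /=.
  by move=> [x01 Wx]; split=> //; split=> //; case/andP: x01.
by move=> [[_ Wx] x01].
Qed.

(** Supplies the averaging equation of [harmonic_eq0] for any family of events compatible with one
    transition. *)
Lemma fine_mu_cons (W : nat -> set (nat -> letter s)) q :
  (forall q, measurable (digits_in R (W q))) ->
  (forall q a w, W q (scons a w) = W (step n q a) w) ->
  k%:R * fine (mu (digits_in R (W q))) =
  \sum_(a : letter s) fine (mu (digits_in R (W (step n q a)))).
Proof.
move=> mW Wcons; apply: EFin_inj.
rewrite EFinM fineK ?fin_num_mu_digits_in // mu_digits_in_cons // -sumEFin.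
apply: eq_bigr => a _; rewrite fineK ?fin_num_mu_digits_in //.
congr (mu (digits_in _ _)).
by apply/funext => w; rewrite Wcons.
Qed.

(** The avoidance probability is harmonic and vanishes at both sinks, so [harmonic_eq0] applies. *)
Lemma mu_avoids_sinks : mu (digits_in R (avoids_sinks 0)) = 0%E.
Proof.
have mA q : measurable (digits_in R (avoids_sinks q)).
  rewrite digits_inE; apply: measurableI; last exact: measurable_itv.
  exact: measurable_avoids_sinks.
have sink0 q : (n.+1 < q)%N -> fine (mu (digits_in R (avoids_sinks q))) = 0.
  move=> lt_q; rewrite (_ : digits_in _ _ = set0) ?measure0 //.
  apply/seteqP; split=> x //= [_ /(_ 0%N)] /=.
  by rewrite leqNgt lt_q.
pose f q := fine (mu (digits_in R (avoids_sinks q))).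
have f0 : f 0%N = 0.
  apply: (@harmonic_eq0 f) => // [|q]; first by rewrite /f !sink0 ?addr0.
  by apply: fine_mu_cons => // *; exact: avoids_sinks_cons.
by rewrite -[LHS]fineK ?fin_num_mu_digits_in // -/(f 0%N) f0.
Qed.

Lemma reaches_sink q' q : (n.+1 < q)%N ->
  reaches q' q = if q == q' then setT else set0.
Proof.
move=> lt_q; case: eqP => [->|neq]; apply/seteqP; split=> w //.
  by move=> _; exists 0%N.
by move=> [i]; rewrite runn_sink.
Qed.

(** The difference of the two probabilities is harmonic with values 1 and -1 at the sinks, whose sum
    is 0. *)
Lemma mu_reaches_sinks q : (q <= n.+1)%N ->
  mu (digits_in R (reaches n.+2 q)) = mu (digits_in R (reaches n.+3 q)).
Proof.
have mR q' p : measurable (digits_in R (reaches q' p)).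
  rewrite digits_inE; apply: measurableI; last exact: measurable_itv.
  exact: measurable_reaches.
pose f q' p := fine (mu (digits_in R (reaches q' p))).
have f_sink q' p : (n.+1 < p)%N -> f q' p = (p == q')%:R.
  move=> lt_p; rewrite /f reaches_sink //; case: eqP => _.
    by rewrite mu_digits_inT.
  by rewrite (_ : digits_in R set0 = set0) ?measure0 // -subset0 => x [].
have fE q' p : (n.+1 < q')%N ->
    k%:R * f q' p = \sum_(a : letter s) f q' (step n p a).
  by move=> lt_q'; apply: fine_mu_cons => // *; exact: reaches_cons.
move=> le_q; rewrite -[LHS]fineK ?fin_num_mu_digits_in //.
rewrite -[RHS]fineK ?fin_num_mu_digits_in //; congr EFin.
apply/eqP; rewrite -subr_eq0; apply/eqP.
apply: (@harmonic_eq0 (fun p => f n.+2 p - f n.+3 p)) => // [|p].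
  by rewrite !f_sink // !eqxx (ltn_eqF (ltnSn _)) (gtn_eqF (ltnSn _)); ring.
by rewrite mulrBr !fE // -sumrB.
Qed.

Lemma limavg_prepend b u w :
  let q := runn n 0 (nth ord0 u) (size u) in
  limavg R (aut s n b) (prepend u w) =
    ((-1) ^+ b * (\1_(reaches n.+2 q) w - \1_(reaches n.+3 q) w))%:E.
Proof.
move=> q.
have runE i : runn n 0 (prepend u w) (size u + i) = runn n q w i.
  rewrite runn_add; congr runn; last first.
    by apply/funext => t; rewrite /prepend ltnNge leq_addr addKn.
  by apply: eq_runn => t lt_t; rewrite /prepend lt_t.
have reachesE q' : (n.+1 < q')%N -> reaches q' q w ->
    limavg R (aut s n b) (prepend u w) = (ratr (weight n b q'))%:E.
  move=> lt_q' [i qi]; have run_i := runE i; rewrite qi in run_i.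
  by rewrite (@limavg_sink _ _ _ _ _ (size u + i)) run_i.
have reaches_uniq : reaches n.+2 q w -> reaches n.+3 q w -> False.
  move=> [i qi] [j qj]; have [le_ij|le_ji] := leqP i j.
    by have := @runn_sink_le s n q w _ _ le_ij; rewrite qi qj; lia.
  by have := @runn_sink_le s n q w _ _ (ltnW le_ji); rewrite qi qj; lia.
rewrite !indicE.
have [/set_mem r2|/negP r2] := boolP (w \in reaches n.+2 q).
  rewrite (reachesE n.+2) // /weight eqxx rmorphXn /= rmorphN1.
  by rewrite memNset ?subr0 ?mulr1 // => /(reaches_uniq r2).
have [/set_mem r3|/negP r3] := boolP (w \in reaches n.+3 q).
  rewrite (reachesE n.+3) // /weight eqxx gtn_eqF // rmorphXn /= rmorphN1.
  by rewrite sub0r signrN mulrN mulr1.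
(* Here no sink is reached from [q]; one met inside [u] would persist, so the whole run is
   transient. *)
rewrite subrr mulr0 limavg_transient // => i.
rewrite leqNgt; apply/negP => lt_i.
have lt_q j : (i <= j)%N -> runn n 0 (prepend u w) j = runn n 0 (prepend u w) i.
  by move=> le_ij; exact: runn_sink_le.
have lt4 : (runn n 0 (prepend u w) i < n.+4)%N.
  by rewrite -(run_aut n b) ltn_ord.
have runi : runn n q w i = runn n 0 (prepend u w) i.
  by rewrite -runE lt_q // leq_addl.
have [eq2|neq2] := eqVneq (runn n 0 (prepend u w) i) n.+2.
  by apply/r2/mem_set; exists i; rewrite runi.
by apply/r3/mem_set; exists i; rewrite runi; lia.
Qed.

Lemma cond_exp_transient b u : (runn n 0 (nth ord0 u) (size u) <= n.+1)%N ->
  cond_exp (limavg R (aut s n b)) u = 0%E.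
Proof.
set q := runn _ _ _ _ => le_q; rewrite /cond_exp.
(* The upper bound on [x] is left to the integration domain; intersecting with it recovers
   [digits_in]. *)
pose A q' := [set x : R | 0 <= x /\ reaches q' q (digits s x)].
have mA q' : measurable (A q') by exact: measurable_reaches.
pose g x : R := \1_(A n.+2) x - \1_(A n.+3) x.
have mg D : measurable_fun D g.
  by apply: measurable_funB; apply: measurable_indic.
under eq_integral => x /set_mem /= /andP[x0 _].
  rewrite limavg_prepend -/q.
  have indicA q' : \1_(reaches q' q) (digits s x) = \1_(A q') x :> R.
    rewrite !indicE; congr (nat_of_bool _)%:R; apply/idP/idP.
      by move=> /set_mem xq; apply/mem_set.
    by move=> /set_mem [_ xq]; apply/mem_set.
  rewrite !indicA -/(g x).
  over.
(* Dropping the endpoint 1 leaves the integral unchanged and matches the interval of [digits_in]. *)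
rewrite -set_itvcc -integral_itv_bndo_bndc; last first.
  by apply/measurable_EFinP; apply: measurable_funM.
have mD : measurable (`[0, 1[ : set (measurableTypeR R)).
  exact: measurable_itv.
have muA q' : mu (A q' `&` `[0, 1[) = mu (digits_in R (reaches q' q)).
  by rewrite digits_inE.
have finA q' : mu (A q' `&` `[0, 1[) \is a fin_num.
  rewrite muA fin_num_mu_digits_in // digits_inE.
  exact: (measurableI _ _ (mA q') mD).
have mu_diff :
    (mu (A n.+2 `&` `[0%R, 1%R[) - mu (A n.+3 `&` `[0%R, 1%R[) = 0)%E.
  by rewrite !muA mu_reaches_sinks // subee // -muA.
have intA q' : mu.-integrable `[0, 1[ (EFin \o \1_(A q')).
  apply/integrableP; split.
    by apply/measurable_EFinP; apply: measurable_indic; exact: mA.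
  have -> : (\int[mu]_(x in `[0%R, 1%R[) `|(EFin \o \1_(A q')) x| =
      \int[mu]_(x in `[0%R, 1%R[) (\1_(A q') x)%:E)%E.
    by apply: eq_integral => x _; rewrite /= indicE normr_nat.
  rewrite integral_indic; [|exact: mD|exact: mA].
  by rewrite ltey_eq finA.
under eq_integral do rewrite EFinM.
have intg : mu.-integrable `[0, 1[ (EFin \o g).
  have := integrableB mD (intA n.+2) (intA n.+3).
  by congr (_.-integrable _ _); apply/funext => x.
rewrite integralZl //.
rewrite [X in (_ * X)%E](_ : _ = 0%E) ?mule0 //.
under eq_integral do rewrite EFinB.
rewrite integralB_EFin //.
rewrite !integral_indic; try exact: mD; try exact: mA.
exact: mu_diff.
Qed.

End Value.

(** Off a null set a sink is reached and the values are opposite units. The point 1 joins the null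
    set because [digits_in] omits it. *)
Lemma ae_word_sinks (R : realType) (s n : nat) :
  ae_word R (fun w : nat -> letter s =>
    (`| limavg R (aut s n false) w - limavg R (aut s n true) w | = 2%:E)%E).
Proof.
have mA : measurable (digits_in R (@avoids_sinks s n 0)).
  rewrite digits_inE; apply: measurableI; last exact: measurable_itv.
  exact: measurable_avoids_sinks.
have negA : (@lebesgue_measure R).-negligible
    (digits_in R (@avoids_sinks s n 0) `|` [set 1])%classic.
  apply: negligibleU; apply/negligibleP => //; first exact: mu_avoids_sinks.
  exact: lebesgue_measure_set1.
apply: negligibleS negA.
move=> x /= [/andP[x0 x1]]; apply: contra_notP => /not_orP[/= avoids x_neq1].
have [w_avoids|/asboolPn] := pselect (avoids_sinks n 0 (digits s x)).
  case: avoids; split=> //; rewrite x0 lt_neqAle x1 andbT.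
  exact/eqP.
move=> /asboolPn /existsNP[i /negP]; rewrite -ltnNge => lt_i.
rewrite !(limavg_sink _ _ lt_i).
have lt4 : (runn n 0 (digits s x) i < n.+4)%N.
  by rewrite -(run_aut n true) ltn_ord.
rewrite /weight; case: eqP => [_|neq2].
  by rewrite expr0 expr1 rmorphN1 rmorph1 -EFinB abse_EFin opprK ger0_norm.
case: eqP => [_|]; last by lia.
rewrite expr0 expr1 rmorphN1 rmorph1 -EFinB abse_EFin -opprD normrN.
by rewrite ger0_norm.
Qed.

(** * Flipping one letter of an example *)

Section Toggle.
Variable s : nat.
Implicit Types (u v : seq (letter s)) (e : seq (letter s) * seq (letter s)).

(** [rev_ord] is an involution that moves [ord0] for every alphabet size considered; an out-of-range
    [t] changes nothing. *)
Definition toggle t u : seq (letter s) :=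
  mkseq (fun i => let c := nth ord0 u i in if i == t then rev_ord c else c)
    (size u).

Lemma size_toggle t u : size (toggle t u) = size u.
Proof. by rewrite size_mkseq. Qed.

Lemma nth_toggle t u i : (t < size u)%N ->
  nth ord0 (toggle t u) i =
  if i == t then rev_ord (nth ord0 u t) else nth ord0 u i.
Proof.
move=> lt_t; have [lt_i|le_i] := ltnP i (size u).
  by rewrite nth_mkseq //; case: eqP => [->|].
by rewrite gtn_eqF ?(leq_trans lt_t) // !nth_default ?size_toggle.
Qed.

Lemma toggleK t : involutive (toggle t).
Proof.
move=> u; apply: (@eq_from_nth _ ord0); rewrite ?size_toggle // => i lt_i.
by rewrite !nth_mkseq ?size_toggle //; case: eqP => // _; exact: rev_ordK.
Qed.

Lemma rev_ord0_neq : rev_ord (ord0 : letter s) != ord0.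
Proof. by []. Qed.

(** Slots are numbered along [e.1 ++ e.2], but the flip stays inside one component, so both lengths
    and hence the weight survive. *)
Definition toggle2 t e :=
  if (t < size e.1)%N then (toggle t e.1, e.2)
  else (e.1, toggle (t - size e.1)%N e.2).

Lemma size1_toggle2 t e : size (toggle2 t e).1 = size e.1.
Proof. by rewrite /toggle2; case: ifP; rewrite //= size_toggle. Qed.

Lemma size2_toggle2 t e : size (toggle2 t e).2 = size e.2.
Proof. by rewrite /toggle2; case: ifP; rewrite //= size_toggle. Qed.

Lemma toggle2K t : involutive (toggle2 t).
Proof.
move=> [u v]; rewrite /toggle2 /=.
by case lt_tu: (t < size u)%N; rewrite /= ?size_toggle lt_tu toggleK.
Qed.

Lemma nth_toggle2 t e i : (t < size e.1 + size e.2)%N ->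
  nth ord0 ((toggle2 t e).1 ++ (toggle2 t e).2) i =
  if i == t then rev_ord (nth ord0 (e.1 ++ e.2) t)
  else nth ord0 (e.1 ++ e.2) i.
Proof.
case: e => u v /= lt_t; rewrite /toggle2 /=; case: ltnP => [lt_tu|le_ut] /=.
  rewrite !nth_cat size_toggle lt_tu nth_toggle //.
  by case: eqP => [->|_]; rewrite ?lt_tu.
rewrite !nth_cat [(t < _)%N]ltnNge le_ut /=; case: ltnP => [lt_iu|le_ui].
  by rewrite ltn_eqF // (leq_trans lt_iu).
rewrite nth_toggle; last by lia.
by rewrite -(eqn_add2r (size u)) !subnK.
Qed.

Definition upw_pos e t : nat :=
  if (t < size e.1)%N then t else (size e.1 + (t - size e.1) %% size e.2)%N.

Lemma upwE e t : upw e.1 e.2 t = nth ord0 (e.1 ++ e.2) (upw_pos e t).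
Proof.
rewrite /upw /upw_pos nth_cat; case: ifP => [->//|_].
by rewrite ltnNge leq_addr addKn.
Qed.

Lemma upw_pos_toggle2 t e : upw_pos (toggle2 t e) =1 upw_pos e.
Proof. by move=> i; rewrite /upw_pos size1_toggle2 size2_toggle2. Qed.

Lemma upw_pos_lt e t : e.2 != [::] -> (upw_pos e t < size e.1 + size e.2)%N.
Proof.
rewrite -size_eq0 -lt0n /upw_pos => v_gt0; case: ifP => [lt_t|_]; first by lia.
by rewrite ltn_add2l ltn_pmod.
Qed.

(** Past [u] the word is periodic, so folding a time back into the example does not change what is
    read afterwards. *)
Lemma upw_pos_add e t i : upw_pos e (upw_pos e t + i) = upw_pos e (t + i).
Proof.
rewrite {2}/upw_pos; case: ltnP => // le_ut.
have leD a : (size e.1 + a < size e.1)%N = false by lia.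
rewrite -addnA /upw_pos leD (_ : (t + i < size e.1)%N = false); last by lia.
by rewrite addKn modnDml -addnBAC.
Qed.

End Toggle.

(** * Bounds for the three kinds of samples *)

Section Bound.
Variables (R : realType) (s n : nat).
Implicit Types (u v : seq (letter s)).
Local Notation A := (aut s n false).
Local Notation Ab := (aut s n true).

Lemma geomw_toggle (l : R) t u : geomw l (toggle t u) = geomw l u.
Proof. by rewrite /geomw size_toggle. Qed.

Lemma geomw_ge0 (l : R) u : 0 < l < 1 -> 0 <= geomw l u.
Proof.
move=> /andP[l0 l1]; rewrite /geomw !mulr_ge0 ?invr_ge0 ?exprn_ge0 //; lra.
Qed.

(** A general flip-invariant [p] covers E-samples and (E,k)-samples at once. If no example reaches a
    sink, all labels are 0 and both automata are consistent. *)
Lemma prob_distinguishesE (p : seq (letter s) -> R) (T : dlimavg s) m :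
  (forall u, 0 <= p u) -> (forall t u, p (toggle t u) = p u) ->
  T = A \/ T = Ab ->
  (\esum_(S in [set: m.-tuple (seq (letter s))])
     ((\prod_(u <- S) p u)%:E * ((distinguishesE R T A Ab S)%:R)%:E)
   <= ((2%:R ^+ n)^-1)%:E *
     \esum_(S in [set: m.-tuple (seq (letter s))])
     ((\prod_(u <- S) p u)%:E * ((normE S)%:R)%:E))%E.
Proof.
move=> p_ge0 p_toggle TA.
(* For [n = 0] the second bound alone would allow [j = size u], which no letter of [u] pays for. *)
pose V u j := (j < size u)%N /\ (j + n <= size u)%N.
apply: (prob_occ_le (size_ex := size) (lett := nth ord0)
  (pos := fun _ t => t) (a0 := ord0) (V := V) (n := n)
  (@rev_ord0_neq s) (@toggleK s) _ _ p_toggle p_ge0).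
- by [].
- by move=> t u j; rewrite /V size_toggle.
- by move=> t u i lt_t; rewrite nth_toggle.
- by move=> u j [].
- by move=> u j i [_ le_jn] lt_i /=; lia.
- by move=> u j i i' _ _ lt_i'; rewrite eqn_add2l ltn_eqF.
move=> S dist_S.
have [/hasP[u uS bad_u]|/hasPn good] :=
    boolP (has (fun u => n.+1 < runn n 0 (nth ord0 u) (size u))%N S).
  exists u => //; have [j lt_j [zeros _]] := runn_sink_pattern bad_u.
  by exists j => //; split; lia.
have cond0 b u : u \in S -> cond_exp (limavg R (aut s n b)) u = 0%E.
  by move=> /good; rewrite -leqNgt; exact: cond_exp_transient.
have consT b : consistentE R T (aut s n b) S.
  apply/allP => u uS; rewrite cond0 //.
  by case: TA => ->; rewrite cond0.
by move: dist_S; rewrite /distinguishesE !consT.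
Qed.

(** Folding the start back makes it chargeable to a letter of [e]; distinct slots, however short [v]
    is, let each zero be flipped independently. *)
Lemma pattern_upw (e : seq (letter s) * seq (letter s)) j :
  e.2 != [::] -> pattern_at n (upw e.1 e.2) j ->
  let j' := upw_pos e j in
  (forall i, (i < n)%N -> nth ord0 (e.1 ++ e.2) (upw_pos e (j' + i)) = ord0) /\
  (forall i i', (i < n)%N -> (i' < i)%N ->
     upw_pos e (j' + i') != upw_pos e (j' + i)).
Proof.
move=> v_neq0 [zeros one] /=; split=> [i lt_i|i i' lt_i lt_i'].
  by rewrite upw_pos_add -upwE zeros.
(* Otherwise shifting by n - i would identify the letter 1 at offset n with
   the letter 0 at offset n - (i - i'). *)
rewrite !upw_pos_add; apply/eqP => eq_pos.
have := one; rewrite upwE (_ : j + n = j + i + (n - i))%N; last by lia.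
rewrite -upw_pos_add -eq_pos upw_pos_add -upwE.
by rewrite -addnA zeros //; lia.
Qed.

Lemma prob_distinguishesU (l1 l2 : R) (T : dlimavg s) m :
  0 < l1 < 1 -> 0 < l2 < 1 -> T = A \/ T = Ab ->
  (\esum_(S in [set: m.-tuple (seq (letter s) * seq (letter s))])
     ((\prod_(e <- S) (geomw l1 e.1 * geomw l2 e.2))%:E
        * ((distinguishesU R T A Ab S)%:R)%:E)
   <= ((2%:R ^+ n)^-1)%:E *
     \esum_(S in [set: m.-tuple (seq (letter s) * seq (letter s))])
     ((\prod_(e <- S) (geomw l1 e.1 * geomw l2 e.2))%:E
        * ((normU S)%:R)%:E))%E.
Proof.
move=> l1_01 l2_01 TA.
pose V (e : seq (letter s) * seq (letter s)) j :=
  [/\ e.2 != [::], (j < size e.1 + size e.2)%N &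
    forall i i', (i < n)%N -> (i' < i)%N ->
      upw_pos e (j + i') != upw_pos e (j + i)].
apply: (prob_occ_le (size_ex := fun e => (size e.1 + size e.2)%N)
  (lett := fun e => nth ord0 (e.1 ++ e.2)) (pos := @upw_pos s)
  (p := fun e => geomw l1 e.1 * geomw l2 e.2)
  (a0 := ord0) (V := V) (n := n) (@rev_ord0_neq s) (@toggle2K s)
  (@upw_pos_toggle2 s)).
- move=> t e j [v_neq0 lt_j inj]; split.
  + by rewrite -size_eq0 size2_toggle2 size_eq0.
  + by rewrite size1_toggle2 size2_toggle2.
  + by move=> i i' lt_i lt_i'; rewrite !upw_pos_toggle2; exact: inj.
- by move=> t e; rewrite /geomw size1_toggle2 size2_toggle2.
- by move=> e; rewrite mulr_ge0 // geomw_ge0.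
- by move=> t e i lt_t; rewrite nth_toggle2.
- by move=> e j [].
- by move=> e j i [v_neq0 _ _] _; exact: upw_pos_lt.
- by move=> e j i i' [_ _ inj]; exact: inj.
move=> S dist_S.
have [/hasP[e eS /andP[v_neq0 neq_e]]|/hasPn good] :=
    boolP (has (fun e => (e.2 != [::]) &&
      (limavg R A (upw e.1 e.2) != limavg R Ab (upw e.1 e.2))) S).
  exists e => //.
  (* Both automata pass through the same states, and without a sink both values are 0, so differing
     values force a sink. *)
  have [i lt_i] : exists i, (n.+1 < runn n 0 (upw e.1 e.2) i)%N.
    apply: contra_notP (elimN eqP neq_e) => /forallNP run_le.
    by rewrite !limavg_transient // => i; rewrite leqNgt; apply/negP;
      exact: run_le.
  have [j _ /(pattern_upw v_neq0)[zeros inj]] := runn_sink_pattern lt_i.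
  exists (upw_pos e j) => //; split=> //; exact: upw_pos_lt.
have limavg_eq b e : e \in S -> e.2 != [::] ->
    limavg R (aut s n b) (upw e.1 e.2) = limavg R A (upw e.1 e.2).
  move=> eS v_neq0; case: b; last by [].
  by have := good e eS; rewrite /= v_neq0 negbK => /eqP <-.
have consT b : consistentU R T (aut s n b) S.
  apply/allP => e eS; have [->//|v_neq0] := eqVneq e.2 [::].
  by rewrite orFb limavg_eq //; case: TA => ->; rewrite limavg_eq.
by move: dist_S; rewrite /distinguishesU !consT.
Qed.

Lemma unifw_toggle kk t u : unifw R kk (toggle t u) = unifw R kk u.
Proof. by rewrite /unifw size_toggle. Qed.

Lemma unifw_ge0 kk u : 0 <= unifw R kk u.
Proof. by rewrite /unifw; case: eqP => // _; rewrite invr_ge0 exprn_ge0. Qed.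

End Bound.

Unset Implicit Arguments.

(* Random samples consist of m i.i.d. examples; the probability that the
   sample distinguishes A and Ab is bounded by E[||S||] / 2^n. *)
Theorem theorem2 (R : realType) (s n : nat) :
  exists A Ab : dlimavg s,
    [/\ nst A = (n + 4)%N, nst Ab = (n + 4)%N,
        (forall q a, @wt _ A q a \in [:: -1; 0; 1]) /\
        (forall q a, @wt _ Ab q a \in [:: -1; 0; 1]),
        ae_word R (fun w => (`| limavg R A w - limavg R Ab w | = 2%:E)%E) &
        forall T : dlimavg s, T = A \/ T = Ab -> forall m : nat,
        [/\ (* U-samples *)
            forall l1 l2 : R, 0 < l1 < 1 -> 0 < l2 < 1 ->
            (\esum_(S in [set: m.-tuple (seq (letter s) * seq (letter s))])
               ((\prod_(e <- S) (geomw l1 e.1 * geomw l2 e.2))%:E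
                  * ((distinguishesU R T A Ab S)%:R)%:E)
             <= ((2%:R ^+ n)^-1)%:E *
               \esum_(S in [set: m.-tuple (seq (letter s) * seq (letter s))])
               ((\prod_(e <- S) (geomw l1 e.1 * geomw l2 e.2))%:E
                  * ((normU S)%:R)%:E))%E,
            (* E-samples *)
            forall l : R, 0 < l < 1 ->
            (\esum_(S in [set: m.-tuple (seq (letter s))])
               ((\prod_(u <- S) geomw l u)%:E
                  * ((distinguishesE R T A Ab S)%:R)%:E)
             <= ((2%:R ^+ n)^-1)%:E *
               \esum_(S in [set: m.-tuple (seq (letter s))])
               ((\prod_(u <- S) geomw l u)%:E * ((normE S)%:R)%:E))%E &
            (* (E,k)-samples *)
            forall kk : nat,
            (\esum_(S in [set: m.-tuple (seq (letter s))])
               ((\prod_(u <- S) unifw R kk u)%:E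
                  * ((distinguishesE R T A Ab S)%:R)%:E)
             <= ((2%:R ^+ n)^-1)%:E *
               \esum_(S in [set: m.-tuple (seq (letter s))])
               ((\prod_(u <- S) unifw R kk u)%:E * ((normE S)%:R)%:E))%E]].
Proof.
exists (aut s n false), (aut s n true); split.
- by rewrite addnC.
- by rewrite addnC.
- have wtP b q : (weight n b q : rat) \in [:: -1; 0; 1].
    by rewrite /weight; case: ifP => _; [|case: ifP => _]; case: b.
  by split=> q a; exact: wtP.
- exact: ae_word_sinks.
move=> T TA m; split=> [l1 l2 l1_01 l2_01|l l01|kk].
- exact: prob_distinguishesU.
- apply: prob_distinguishesE => // [u|t u]; first exact: geomw_ge0.
  exact: geomw_toggle.
- apply: prob_distinguishesE => // [u|t u]; first exact: unifw_ge0.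
  exact: unifw_toggle.
Qed.
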